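(* Let $Q$ be a Dynkin quiver, $\mathbf{d}\in\mathbb{N}^{Q_0}$, and let $N$ be a point in $\mathrm{rep}_Q^{\mathbf{d}}(\Bbbk)$ with a fixed decomposition $N=\bigoplus_{s\in\mathcal{S}}N^s$ as a representation of $Q$. Consider the representation $L=N+\widehat{Z^{p,q}}$ in $\mathrm{rep}_Q^{\mathbf{d}}(\Bbbk)$ for $Z^{p,q}\in\mathbb{Z}^1_Q(N^q,N^p)$ and two indices $p\neq q$ in $\mathcal{S}$. Then the following conditions hold: (1) $\delta_{L,N}=\delta_{\sigma(N^p,Z^{p,q},N^q)}$. (2) $L$ degenerates to $N$, i.e. $N\in\overline{\mathcal{O}}_L(\Bbbk)$. (3) $L\simeq N$ if and only if $Z^{p,q}$ belongs to $\mathbb{B}^1_Q(N^q,N^p)$.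
   Context: $\Bbbk$ is an algebraically closed field; a Dynkin quiver is one whose underlying graph is of type $\mathbb{A}_n,\mathbb{D}_n,\mathbb{E}_6,\mathbb{E}_7,\mathbb{E}_8$; an arrow $\alpha$ goes from $s\alpha$ to $t\alpha$. $\mathrm{rep}_Q^{\mathbf{d}}=\prod_\alpha\mathbb{M}_{\mathbf{d}_{t\alpha}\times\mathbf{d}_{s\alpha}}$ with the conjugation action of $\mathrm{GL}_{\mathbf{d}}$; $\mathcal{O}_L$ is the orbit of points isomorphic to $L$ and $\overline{\mathcal{O}}_L$ its Zariski closure. For representations $U,V$: $\mathbb{Z}^1_Q(V,U)=\prod_\alpha\mathrm{Hom}_\Bbbk(V_{s\alpha},U_{t\alpha})$, and $\mathbb{B}^1_Q(V,U)\subseteq\mathbb{Z}^1_Q(V,U)$ is the image of the map $\prod_{a\in Q_0}\mathrm{Hom}_\Bbbk(V_a,U_a)\to\mathbb{Z}^1_Q(V,U)$, $h\mapsto(h_{t\alpha}V_\alpha-U_\alpha h_{s\alpha})_\alpha$. For $Z\in\mathbb{Z}^1_Q(V,U)$, $\sigma(U,Z,V)$ is the short exact sequence $0\to U\to W\to V\to0$ with $W_a=U_a\oplus V_a$, $W_\alpha=\begin{bmatrix}U_\alpha&Z_\alpha\\0&V_\alpha\end{bmatrix}$ and canonical maps. Given the decomposition of $N$ (so $\Bbbk^{\mathbf{d}_a}=\bigoplus_sN^s_a$), $\widehat{Z^{p,q}}\in\mathrm{rep}_Q^{\mathbf{d}}(\Bbbk)$ is the collection of maps $\Bbbk^{\mathbf{d}_{s\alpha}}\to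 N^q_{s\alpha}\xrightarrow{Z^{p,q}_\alpha}N^p_{t\alpha}\to\Bbbk^{\mathbf{d}_{t\alpha}}$ (canonical projection and inclusion); $N+\widehat{Z^{p,q}}$ is the sum in the vector space $\mathrm{rep}_Q^{\mathbf{d}}(\Bbbk)$. $[X,Y]=\dim_\Bbbk\mathrm{Hom}_Q(X,Y)$. For representations $M',N'$ with the same dimension vector, $\delta_{M',N'}$ is the function on isomorphism classes of non-projective indecomposable representations $X$ given by $\delta_{M',N'}(X)=[X,N']-[X,M']$; for a short exact sequence $\sigma:0\to A\to B\to C\to0$, $\delta_\sigma=\delta_{B,A\oplus C}$. *)

(* Defs.v *)
From HB Require Import structures.
From mathcomp Require Import all_boot all_order all_algebra.
From mathcomp Require Import mpoly.

Set Implicit Arguments.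
Unset Strict Implicit.
Unset Printing Implicit Defensive.

Import GRing.Theory.
Local Open Scope ring_scope.

(* The product of a finite family of vector spaces; MathComp only equips the
   non-dependent {ffun I -> V} with a vectType structure.                    *)
Section FamilyVectType.
Variables (k : fieldType) (I : finType) (V : I -> vectType k).

Record vfam := VFam { vfam_val : {dffun forall i, V i} }.

Definition vfam_fun (f : vfam) : forall i, V i := fun i => vfam_val f i.
Definition mkvfam (f : forall i, V i) : vfam := VFam [ffun i => f i].
Coercion vfam_fun : vfam >-> Funclass.

Lemma mkvfamE f i : mkvfam f i = f i. Proof. exact: ffunE. Qed.
Lemma vfamP (f g : vfam) : (forall i, f i = g i) <-> f = g.
Proof. by split=> [fg|->//]; case: f g fg => [f] [g] fg; congr VFam; apply/ffunP. Qed.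

HB.instance Definition _ := [isNew for vfam_val].
HB.instance Definition _ := [Choice of vfam by <:].

Definition vfam_zero : vfam := mkvfam (fun=> 0).
Definition vfam_opp (f : vfam) : vfam := mkvfam (fun i => - f i).
Definition vfam_add (f g : vfam) : vfam := mkvfam (fun i => f i + g i).
Definition vfam_scale (c : k) (f : vfam) : vfam := mkvfam (fun i => c *: f i).

Fact vfam_addA : associative vfam_add.
Proof. by move=> f g h; apply/vfamP => i; rewrite !mkvfamE addrA. Qed.
Fact vfam_addC : commutative vfam_add.
Proof. by move=> f g; apply/vfamP => i; rewrite !mkvfamE addrC. Qed.
Fact vfam_add0 : left_id vfam_zero vfam_add.
Proof. by move=> f; apply/vfamP => i; rewrite !mkvfamE add0r. Qed.
Fact vfam_addN : left_inverse vfam_zero vfam_opp vfam_add.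
Proof. by move=> f; apply/vfamP => i; rewrite !mkvfamE addNr. Qed.
HB.instance Definition _ :=
  GRing.isZmodule.Build vfam vfam_addA vfam_addC vfam_add0 vfam_addN.

Fact vfam_scaleA a b f : vfam_scale a (vfam_scale b f) = vfam_scale (a * b) f.
Proof. by apply/vfamP => i; rewrite !mkvfamE scalerA. Qed.
Fact vfam_scale1 : left_id 1 vfam_scale.
Proof. by move=> f; apply/vfamP => i; rewrite !mkvfamE scale1r. Qed.
Fact vfam_scaleDr : right_distributive vfam_scale +%R.
Proof. by move=> a f g; apply/vfamP => i; rewrite !mkvfamE scalerDr. Qed.
Fact vfam_scaleDl f : {morph vfam_scale^~ f : a b / a + b}.
Proof. by move=> a b; apply/vfamP => i; rewrite !mkvfamE scalerDl. Qed.
HB.instance Definition _ := GRing.Zmodule_isLmodule.Build k vfam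
  vfam_scaleA vfam_scale1 vfam_scaleDr vfam_scaleDl.

Lemma vfam0E i : (0 : vfam) i = 0. Proof. exact: mkvfamE. Qed.
Lemma vfamDE (f g : vfam) i : (f + g) i = f i + g i. Proof. exact: mkvfamE. Qed.
Lemma vfamNE (f : vfam) i : (- f) i = - f i. Proof. exact: mkvfamE. Qed.
Lemma vfamZE c (f : vfam) i : (c *: f) i = c *: f i. Proof. exact: mkvfamE. Qed.

Import VectorInternalTheory.

Fact vfam_vect_iso : Vector.axiom #|{: {i : I & 'I_(dim (V i))}}| vfam.
Proof.
pose cf (f : vfam) (x : {i : I & 'I_(dim (V i))}) : k :=
  v2r (f (tag x)) 0 (tagged x).
exists (fun f => \row_j cf f (enum_val j)).
  move=> c f g; apply/rowP => j; rewrite !mxE /cf vfamDE vfamZE.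
  by rewrite linearP !mxE.
exists (fun r : 'rV_#|_| => mkvfam (fun i =>
  r2v (\row_j r 0 (enum_rank (Tagged (fun i => 'I_(dim (V i))) j))))).
  move=> f; apply/vfamP => i; rewrite mkvfamE -[RHS]v2rK; congr r2v.
  by apply/rowP => j; rewrite !mxE enum_rankK.
move=> r; apply/rowP => j; rewrite mxE /cf mkvfamE r2vK mxE.
congr (r 0 _); rewrite -[RHS]enum_valK; congr enum_rank.
by case: (enum_val j).
Qed.
HB.instance Definition _ := Lmodule_hasFinDim.Build k vfam vfam_vect_iso.

End FamilyVectType.

Record quiver := Quiver {
  vertex : finType;
  arrow : finType;
  src : arrow -> vertex;
  tgt : arrow -> vertex }.

(* dynkinA n, dynkinD n stand for A_(n+1), D_(n+4), so that exactly the types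
   A_n (n >= 1) and D_n (n >= 4) occur.                                      *)
Inductive dynkin_type :=
  dynkinA of nat | dynkinD of nat | dynkinE6 | dynkinE7 | dynkinE8.

Definition dynkin_rank (T : dynkin_type) : nat :=
  match T with
  | dynkinA n => n.+1 | dynkinD n => n.+4
  | dynkinE6 => 6 | dynkinE7 => 7 | dynkinE8 => 8
  end.

(* Nodes 0, ..., m - 2 form a path and node m - 1 is attached to node b. *)
Definition branched_path (m b i j : nat) : bool :=
  ((j == i.+1) && (j < m.-1)%N) || ((i == b) && (j == m.-1)).

(* Edges {i, j} with i < j. *)
Definition dynkin_edge_lt (T : dynkin_type) (i j : nat) : bool :=
  match T with
  | dynkinA _ => j == i.+1
  | dynkinD n => branched_path n.+4 n.+1 i j
  | dynkinE6 => branched_path 6 2 i j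
  | dynkinE7 => branched_path 7 2 i j
  | dynkinE8 => branched_path 8 2 i j
  end.

Definition dynkin_edge (T : dynkin_type) (i j : nat) : bool :=
  dynkin_edge_lt T i j || dynkin_edge_lt T j i.

Definition edges_between (Q : quiver) (x y : vertex Q) : {set arrow Q} :=
  [set a | ((src a == x) && (tgt a == y)) || ((src a == y) && (tgt a == x))].

(* The number of arrows is compared with a boolean, so loops and multiple
   edges are excluded.                                                       *)
Definition has_dynkin_type (Q : quiver) (T : dynkin_type) : Prop :=
  exists2 phi : vertex Q -> 'I_(dynkin_rank T), bijective phi &
    forall x y, #|edges_between x y| = dynkin_edge T (phi x) (phi y).

Definition dynkin_quiver (Q : quiver) : Prop := exists T, has_dynkin_type Q T.

Section Representations.
Variables (k : fieldType) (Q : quiver).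

Record rep := Rep {
  rep_space : vertex Q -> vectType k;
  rep_map : forall a : arrow Q, 'Hom(rep_space (src a), rep_space (tgt a)) }.
Coercion rep_map : rep >-> Funclass.

Definition C0 (V U : rep) : vectType k :=
  vfam (fun x : vertex Q => 'Hom(rep_space V x, rep_space U x)).

Definition Z1 (V U : rep) : vectType k :=
  vfam (fun a : arrow Q => 'Hom(rep_space V (src a), rep_space U (tgt a))).

Definition cobound_fun (V U : rep) (h : C0 V U) : Z1 V U :=
  mkvfam (fun a => (h (tgt a) \o V a)%VF - (U a \o h (src a))%VF).

Fact cobound_fun_is_linear V U : linear (@cobound_fun V U).
Proof.
move=> c f g; apply/vfamP => a.
rewrite !(mkvfamE, vfamDE, vfamZE) comp_lfunDl comp_lfunDr.
rewrite -comp_lfunZl -comp_lfunZr scalerBr opprD.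
by rewrite addrACA.
Qed.
HB.instance Definition _ V U := GRing.isLinear.Build k _ _ _ _
  (@cobound_fun_is_linear V U).

Definition cobound (V U : rep) : 'Hom(C0 V U, Z1 V U) :=
  linfun (@cobound_fun V U).

Definition B1 (V U : rep) : {vspace Z1 V U} := limg (cobound V U).

Definition HomQ (V U : rep) : {vspace C0 V U} := lker (cobound V U).

Lemma HomQP (V U : rep) (h : C0 V U) :
  reflect (forall a, (h (tgt a) \o V a)%VF = (U a \o h (src a))%VF)
          (h \in HomQ V U).
Proof.
rewrite memv_ker lfunE /=; apply: (iffP eqP) => [/vfamP h0 a|hm].
  by have := h0 a; rewrite mkvfamE vfam0E => /eqP; rewrite subr_eq0 => /eqP.
by apply/vfamP => a; rewrite mkvfamE vfam0E hm subrr.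
Qed.

Definition dimHom (X Y : rep) : nat := \dim (HomQ X Y).

Definition rep_iso (X Y : rep) : Prop :=
  exists f g, [/\ f \in HomQ X Y, g \in HomQ Y X,
    forall x, (g x \o f x)%VF = \1%VF & forall x, (f x \o g x)%VF = \1%VF].

Definition rep_zero (X : rep) : Prop :=
  forall x, \dim {: rep_space X x} = 0%N.

(* The middle term of sigma(U, Z, V). *)
Section Extension.
Variables (U V : rep) (Z : Z1 V U).

Definition ext_space x : vectType k := (rep_space U x * rep_space V x)%type.

Definition ext_fun a (w : ext_space (src a)) : ext_space (tgt a) :=
  (U a w.1 + Z a w.2, V a w.2).

Fact ext_fun_is_linear a : linear (@ext_fun a).
Proof.
move=> c u v; rewrite /ext_fun /= !linearP; congr (_, _).
by rewrite /= scalerDr addrACA.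
Qed.
HB.instance Definition _ a := GRing.isLinear.Build k _ _ _ _
  (@ext_fun_is_linear a).

Definition ext_rep : rep := @Rep ext_space (fun a => linfun (@ext_fun a)).
End Extension.

Section DirectSum.
Variables (U V : rep).

Definition dsum_fun a (w : ext_space U V (src a)) : ext_space U V (tgt a) :=
  (U a w.1, V a w.2).

Fact dsum_fun_is_linear a : linear (@dsum_fun a).
Proof. by move=> c u v; rewrite /dsum_fun /= !linearP. Qed.
HB.instance Definition _ a := GRing.isLinear.Build k _ _ _ _
  (@dsum_fun_is_linear a).

Definition dsum : rep := @Rep (ext_space U V) (fun a => linfun (@dsum_fun a)).
End DirectSum.

Record ses := Ses {
  ses_sub : rep;
  ses_mid : rep;
  ses_quo : rep;
  ses_in : C0 ses_sub ses_mid;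
  ses_out : C0 ses_mid ses_quo;
  ses_in_hom : ses_in \in HomQ ses_sub ses_mid;
  ses_out_hom : ses_out \in HomQ ses_mid ses_quo;
  ses_inj : forall x, lker (ses_in x) = 0%VS;
  ses_exact : forall x, limg (ses_in x) = lker (ses_out x);
  ses_surj : forall x, limg (ses_out x) = fullv }.

Section Sigma.
Variables (U : rep) (V : rep) (Z : Z1 V U).

Definition ext_in_fun x (u : rep_space U x) : ext_space U V x := (u, 0).
Definition ext_out_fun x (w : ext_space U V x) : rep_space V x := w.2.

Fact ext_in_fun_is_linear x : linear (@ext_in_fun x).
Proof.
by move=> c u v; rewrite /ext_in_fun; congr (_, _); rewrite /= scaler0 addr0.
Qed.
HB.instance Definition _ x := GRing.isLinear.Build k _ _ _ _
  (@ext_in_fun_is_linear x).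
Fact ext_out_fun_is_linear x : linear (@ext_out_fun x).
Proof. by []. Qed.
HB.instance Definition _ x := GRing.isLinear.Build k _ _ _ _
  (@ext_out_fun_is_linear x).

Definition ext_in : C0 U (ext_rep Z) := mkvfam (fun x => linfun (@ext_in_fun x)).
Definition ext_out : C0 (ext_rep Z) V := mkvfam (fun x => linfun (@ext_out_fun x)).

Fact ext_in_hom : ext_in \in HomQ U (ext_rep Z).
Proof.
apply/HomQP => a; apply/lfunP => u; rewrite !comp_lfunE !mkvfamE !lfunE /=.
by rewrite /ext_in_fun /ext_fun /= !linear0 addr0.
Qed.

Fact ext_out_hom : ext_out \in HomQ (ext_rep Z) V.
Proof. by apply/HomQP => a; apply/lfunP => u; rewrite !comp_lfunE !mkvfamE !lfunE. Qed.

Fact ext_inj x : lker (ext_in x) = 0%VS.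
Proof.
apply/eqP/lker0P => u v; rewrite !mkvfamE !lfunE /= => uv.
exact: (congr1 fst uv).
Qed.

Fact ext_exact x : limg (ext_in x) = lker (ext_out x).
Proof.
apply/vspaceP => w; rewrite memv_ker !mkvfamE lfunE /=.
apply/memv_imgP/eqP => [[u _ ->]|w2]; first by rewrite lfunE.
exists w.1; first exact: memvf.
by rewrite lfunE /= /ext_in_fun -w2; case: w {w2}.
Qed.

Fact ext_surj x : limg (ext_out x) = fullv.
Proof.
apply/vspaceP => v; rewrite memvf; apply/memv_imgP.
by exists ((0, v) : ext_space U V x); rewrite ?memvf // mkvfamE lfunE.
Qed.

Definition sigma : ses :=
  Ses ext_in_hom ext_out_hom ext_inj ext_exact ext_surj.
End Sigma.

Definition projective (X : rep) : Prop :=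
  forall (A B : rep) (g : C0 A B) (h : C0 X B),
    g \in HomQ A B -> (forall x, limg (g x) = fullv) -> h \in HomQ X B ->
  exists2 l, l \in HomQ X A & forall x, (g x \o l x)%VF = h x.

Definition indecomposable (X : rep) : Prop :=
  ~ rep_zero X /\
  forall A B, rep_iso X (dsum A B) -> rep_zero A \/ rep_zero B.

Record nonproj_indec := NonprojIndec {
  npi_rep :> rep;
  npi_indec : indecomposable npi_rep;
  npi_nonproj : ~ projective npi_rep }.

(* Constant on isomorphism classes, by delta_iso below. *)
Definition delta (M N : rep) (X : nonproj_indec) : int :=
  (dimHom X N)%:Z - (dimHom X M)%:Z.

Definition delta_ses (s : ses) : nonproj_indec -> int :=
  delta (ses_mid s) (dsum (ses_sub s) (ses_quo s)).

Lemma rep_iso_sym X Y : rep_iso X Y -> rep_iso Y X.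
Proof. by case=> f [g [? ? ? ?]]; exists g, f. Qed.

Lemma leq_dimHom_iso X X' Y : rep_iso X X' -> (dimHom X Y <= dimHom X' Y)%N.
Proof.
case=> f [g [_ /HomQP gP gf _]].
pose c (h : C0 X Y) : C0 X' Y := mkvfam (fun x => (h x \o g x)%VF).
have cl : linear c.
  move=> b u v; apply/vfamP => x.
  by rewrite !(mkvfamE, vfamDE, vfamZE) comp_lfunDl -comp_lfunZl.
pose cL : {linear C0 X Y -> C0 X' Y} :=
  HB.pack c (GRing.isLinear.Build _ _ _ _ c cl).
have c_inj : lker (linfun cL) == 0%VS.
  apply/lker0P => u v; rewrite !lfunE /= => /vfamP uv; apply/vfamP => x.
  have := congr1 (fun h => h \o f x)%VF (uv x).
  by rewrite !mkvfamE -!comp_lfunA gf !comp_lfun1r.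
rewrite /dimHom -(limg_dim_eq (_ : (HomQ X Y :&: lker (linfun cL))%VS = 0%VS)).
  apply: dimvS; apply/subvP => _ /memv_imgP[h /HomQP hP ->].
  apply/HomQP => a; rewrite lfunE /= !mkvfamE.
  by rewrite -comp_lfunA gP !comp_lfunA hP.
by rewrite (eqP c_inj) capv0.
Qed.

Lemma delta_iso M N (X X' : nonproj_indec) :
  rep_iso X X' -> delta M N X = delta M N X'.
Proof.
move=> XX'; rewrite /delta; congr (Posz _ - Posz _).
  by apply/eqP; rewrite eqn_leq !leq_dimHom_iso //; exact: rep_iso_sym.
by apply/eqP; rewrite eqn_leq !leq_dimHom_iso //; exact: rep_iso_sym.
Qed.

Section Points.
Variable d : vertex Q -> nat.

Definition repd : vectType k :=
  vfam (fun a : arrow Q => 'M[k]_(d (tgt a), d (src a))).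

Definition point_rep (M : repd) : rep :=
  @Rep (fun x => 'cV[k]_(d x)) (fun a => linfun (mulmx (M a))).

Definition rep_orbit (L : repd) (M : repd) : Prop :=
  exists2 g : forall x, 'M[k]_(d x), (forall x, g x \in unitmx) &
    forall a, M a = g (tgt a) *m L a *m invmx (g (src a)).

Definition coordinate : finType :=
  {a : arrow Q & ('I_(d (tgt a)) * 'I_(d (src a)))%type}.

Definition coordinates (M : repd) (c : 'I_#|{: coordinate}|) : k :=
  let e := enum_val c in M (tag e) (tagged e).1 (tagged e).2.

Definition zariski_closure (S : repd -> Prop) (M : repd) : Prop :=
  forall f : {mpoly k[#|{: coordinate}|]},
    (forall P, S P -> f.@[coordinates P] = 0) -> f.@[coordinates M] = 0.

Definition degenerates_to (L N : repd) : Prop := zariski_closure (rep_orbit L) N.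

Record decomposition (N : repd) (S : finType) := Decomposition {
  dec_space : S -> forall x, {vspace 'cV[k]_(d x)};
  dec_stable : forall s a v,
    v \in dec_space s (src a) -> N a *m v \in dec_space s (tgt a);
  dec_direct : forall x, directv (\sum_s dec_space s x);
  dec_full : forall x, (\sum_s dec_space s x)%VS = fullv }.

Section Summands.
Variables (N : repd) (S : finType) (D : decomposition N S).

(* By dec_stable, vsproj is only applied to vectors of the subspace, where it
   is the inverse of vsval.                                                  *)
Definition summand_fun s a (v : subvs_of (dec_space D s (src a))) :
    subvs_of (dec_space D s (tgt a)) := vsproj _ (N a *m vsval v).

Fact summand_fun_is_linear s a : linear (@summand_fun s a).
Proof. by move=> c u v; rewrite /summand_fun !linearP. Qed.
HB.instance Definition _ s a := GRing.isLinear.Build k _ _ _ _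
  (@summand_fun_is_linear s a).

Definition summand (s : S) : rep :=
  @Rep (fun x => subvs_of (dec_space D s x))
       (fun a => linfun (@summand_fun s a)).

Definition dec_proj s x (v : 'cV[k]_(d x)) : subvs_of (dec_space D s x) :=
  vsproj _ (sumv_pi (\sum_t dec_space D t x)%VS s v).

Lemma dec_projE s x (v : S -> 'cV[k]_(d x)) :
  (forall t, v t \in dec_space D t x) -> vsval (dec_proj s (\sum_t v t)) = v s.
Proof.
move=> vD; rewrite /dec_proj vsprojK ?memv_sum_pi //.
set w := \sum_t v t; pose u t := sumv_pi (\sum_t dec_space D t x)%VS t w.
have uw : \sum_t u t = w by apply: sumv_pi_sum; rewrite dec_full memvf.
have /directv_sum_unique/(_ u v) := dec_direct D x.
rewrite uw eqxx => /(_ _ _)/esym/forallP/(_ s) H.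
by apply/eqP/H => t _; rewrite ?memv_sum_pi.
Qed.

Definition hat (p q : S) (Z : Z1 (summand q) (summand p)) : repd :=
  mkvfam (fun a => \matrix_(i, j)
    (vsval (Z a (@dec_proj q (src a) (delta_mx j 0)))) i 0).

End Summands.
End Points.
End Representations.

Arguments sigma {k Q} U {V} Z.

(* Main.v *)
From HB Require Import structures.
Require Import Defs.
From mathcomp Require Import all_boot all_order all_algebra.
From mathcomp Require Import mpoly.

(** Write E for the middle term of sigma(N^p, Z, N^q).  E is a retract of
    L = N + hat Z, so [X, L] = [X, E] + dim K, where K is the space of morphisms
    X -> L with zero components in N^p and N^q.  K does not depend on Z;
    comparing with Z = 0 gives (1), for every X.  Rescaling the N^p component by
    t identifies L with N + t hat Z, and a polynomial vanishing at all t <> 0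
    vanishes at t = 0, whence (2).  If Z is the coboundary of h, then 1 - hat h
    is an isomorphism L -> N.  Conversely, if L and N are isomorphic, then
    [N^q, E] = [N^q, N^p] + [N^q, N^q], so the identity of N^q lifts to E, and
    the N^p component of such a section exhibits Z as a coboundary. *)

Set Implicit Arguments.
Unset Strict Implicit.
Unset Printing Implicit Defensive.

Import GRing.Theory.
Local Open Scope ring_scope.

(** * Dimensions of Hom spaces: retracts and extensions *)

Section HomDimension.
Variables (k : fieldType) (Q : quiver).
Implicit Types X Y E U V : rep k Q.

Definition postcomp_fun X Y E (r : C0 Y E) (h : C0 X Y) : C0 X E :=
  mkvfam (fun x => (r x \o h x)%VF).

Fact postcomp_fun_is_linear X Y E (r : C0 Y E) :
  linear (@postcomp_fun X Y E r).
Proof.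
move=> c f g; apply/vfamP => x.
by rewrite !(mkvfamE, vfamDE, vfamZE) comp_lfunDr -comp_lfunZr.
Qed.
HB.instance Definition _ X Y E (r : C0 Y E) := GRing.isLinear.Build k _ _ _ _
  (@postcomp_fun_is_linear X Y E r).

Definition postcomp X Y E (r : C0 Y E) : 'Hom(C0 X Y, C0 X E) :=
  linfun (@postcomp_fun X Y E r).

Lemma postcompE X Y E (r : C0 Y E) (h : C0 X Y) x :
  postcomp X r h x = (r x \o h x)%VF.
Proof. by rewrite lfunE /= mkvfamE. Qed.

Lemma postcomp_HomQ X Y E (r : C0 Y E) (h : C0 X Y) :
  r \in HomQ Y E -> h \in HomQ X Y -> postcomp X r h \in HomQ X E.
Proof.
move=> /HomQP rP /HomQP hP; apply/HomQP => a.
by rewrite !postcompE -comp_lfunA hP !comp_lfunA rP.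
Qed.

Lemma postcomp_img_sub X Y E (r : C0 Y E) :
  r \in HomQ Y E -> (postcomp X r @: HomQ X Y <= HomQ X E)%VS.
Proof.
by move=> rP; apply/subvP => _ /memv_imgP[h hP ->]; apply: postcomp_HomQ.
Qed.

Lemma dimHom_postcomp X Y E (r : C0 Y E) :
  dimHom X Y = (\dim (HomQ X Y :&: lker (postcomp X r))
                + \dim (postcomp X r @: HomQ X Y))%N.
Proof. by rewrite limg_ker_dim. Qed.

(** Postcomposition with [r] is onto, since [h = r (i h)]; rank-nullity gives the equation. *)
Lemma dimHom_retract X Y E (i : C0 E Y) (r : C0 Y E) :
    i \in HomQ E Y -> r \in HomQ Y E -> (forall x, (r x \o i x)%VF = \1%VF) ->
  dimHom X Y = (\dim (HomQ X Y :&: lker (postcomp X r)) + dimHom X E)%N.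
Proof.
move=> iP rP ri; rewrite (dimHom_postcomp X r); congr (_ + \dim _)%N.
apply/eqP; rewrite eqEsubv postcomp_img_sub //=.
apply/subvP => h hP; apply/memv_imgP; exists (postcomp X i h).
  exact: postcomp_HomQ.
by apply/vfamP => x; rewrite !postcompE comp_lfunA ri comp_lfun1l.
Qed.

Lemma dimHom_iso_le X Y E : rep_iso Y E -> (dimHom X E <= dimHom X Y)%N.
Proof.
case=> f [g [fP gP _ fg]].
by rewrite (dimHom_retract X gP fP fg) leq_addl.
Qed.

Lemma dimHom_iso X Y E : rep_iso Y E -> dimHom X Y = dimHom X E.
Proof.
move=> YE; apply/eqP; rewrite eqn_leq !dimHom_iso_le //; exact: rep_iso_sym.
Qed.

(** Left exactness of Hom(X, -): postcomposition with [ext_in Z] is injective and its image is this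
    kernel. *)
Lemma dim_ker_ext_out X U V (Z : Z1 V U) :
  \dim (HomQ X (ext_rep Z) :&: lker (postcomp X (ext_out Z))) = dimHom X U.
Proof.
have inj : lker (postcomp X (ext_in Z)) == 0%VS.
  apply/lker0P => f g /vfamP fg; apply/vfamP => x; apply/lfunP => v.
  have := congr1 (fun h : 'Hom(_, _) => h v) (fg x).
  by rewrite !postcompE !comp_lfunE /ext_in !mkvfamE !lfunE => -[].
have cap0 : (HomQ X U :&: lker (postcomp X (ext_in Z)))%VS = 0%VS.
  by rewrite (eqP inj) capv0.
rewrite /dimHom -(limg_dim_eq cap0); congr (\dim _).
apply/vspaceP => h; rewrite memv_cap memv_ker.
apply/andP/memv_imgP => [[/HomQP hP /eqP/vfamP h0]|[f fP ->]]; last first.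
  split; first by rewrite postcomp_HomQ ?ext_in_hom.
  apply/eqP/vfamP => x; rewrite !postcompE vfam0E; apply/lfunP => v.
  by rewrite !comp_lfunE !mkvfamE !lfunE.
have h2 x v : (h x v).2 = 0.
  have := congr1 (fun h : 'Hom(_, _) => h v) (h0 x).
  by rewrite vfam0E postcompE comp_lfunE mkvfamE !lfunE.
pose f : C0 X U := mkvfam (fun x =>
  (linfun (fst : rep_space (ext_rep Z) x -> rep_space U x) \o h x)%VF).
have fE x v : f x v = (h x v).1 by rewrite /f mkvfamE comp_lfunE lfunE.
exists f.
  apply/HomQP => a; apply/lfunP => v; rewrite !comp_lfunE !fE.
  have := congr1 (fun h : 'Hom(_, _) => h v) (hP a).
  by rewrite !comp_lfunE => ->; rewrite lfunE /= h2 linear0 addr0.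
apply/vfamP => x; apply/lfunP => v; rewrite postcompE comp_lfunE mkvfamE lfunE /=.
by rewrite /ext_in_fun fE -(h2 x v); case: (h x v).
Qed.

Lemma dimHom_ext X U V (Z : Z1 V U) :
  dimHom X (ext_rep Z) =
    (dimHom X U + \dim (postcomp X (ext_out Z) @: HomQ X (ext_rep Z)))%N.
Proof. by rewrite (dimHom_postcomp X (ext_out Z)) dim_ker_ext_out. Qed.

Definition ext0_section_fun U V x (v : rep_space V x) : ext_space U V x :=
  (0, v).

Fact ext0_section_fun_is_linear U V x : linear (@ext0_section_fun U V x).
Proof.
by move=> c u v; rewrite /ext0_section_fun; congr (_, _); rewrite /= scaler0 addr0.
Qed.
HB.instance Definition _ U V x := GRing.isLinear.Build k _ _ _ _
  (@ext0_section_fun_is_linear U V x).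

(** The map v |-> (0, v) is a morphism when [Z = 0] and splits [ext_out], so [dimHom_retract]
    applies. *)
Lemma dimHom_ext0 X U V :
  dimHom X (ext_rep (0 : Z1 V U)) = (dimHom X U + dimHom X V)%N.
Proof.
pose s : C0 V (ext_rep (0 : Z1 V U)) :=
  mkvfam (fun x => linfun (@ext0_section_fun U V x)).
have sP : s \in HomQ V (ext_rep (0 : Z1 V U)).
  apply/HomQP => a; apply/lfunP => v; rewrite !comp_lfunE /s !mkvfamE.
  rewrite (lfunE (@ext0_section_fun U V _)) (lfunE (@ext0_section_fun U V _)) /=.
  by rewrite lfunE /= /ext_fun vfam0E /= linear0 zero_lfunE addr0.
rewrite (dimHom_retract X sP (ext_out_hom 0)) ?dim_ker_ext_out // => x.
apply/lfunP => v; rewrite comp_lfunE /s !mkvfamE.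
by rewrite (lfunE (@ext0_section_fun U V _)) !lfunE.
Qed.

(** [dsum U V] and [ext_rep 0] have the same spaces and equal arrow maps, so the two Hom spaces are
    one and the same subspace. *)
Lemma dimHom_dsum X U V : dimHom X (dsum U V) = (dimHom X U + dimHom X V)%N.
Proof.
rewrite -dimHom_ext0; congr (\dim _); apply/vspaceP => h.
have mapE a : dsum U V a = ext_rep (0 : Z1 V U) a.
  apply/lfunP => w; rewrite !lfunE /= /dsum_fun /ext_fun.
  by rewrite vfam0E zero_lfunE addr0.
by apply/(@HomQP _ _ X (dsum U V))/(@HomQP _ _ X (ext_rep (0 : Z1 V U))) => hP a;
  rewrite hP mapE.
Qed.

(** The first component of the equation making [s] a morphism reads [h V = U h + Z], where [h] is
    the [U] component of [s]. *)
Lemma ext_section_cobound U V (Z : Z1 V U) (s : C0 V (ext_rep Z)) :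
  s \in HomQ V (ext_rep Z) -> (forall x v, (s x v).2 = v) -> Z \in B1 V U.
Proof.
move=> /HomQP sP s2.
pose h : C0 V U := mkvfam (fun x =>
  (linfun (fst : rep_space (ext_rep Z) x -> rep_space U x) \o s x)%VF).
have hE x v : h x v = (s x v).1 by rewrite /h mkvfamE comp_lfunE lfunE.
apply/memv_imgP; exists h; first exact: memvf.
apply/vfamP => a; rewrite lfunE /= mkvfamE; apply/lfunP => v.
rewrite add_lfunE opp_lfunE !comp_lfunE !hE.
have := congr1 (fun h : 'Hom(_, _) => h v) (sP a).
by rewrite !comp_lfunE => ->; rewrite [ext_rep Z a _]lfunE /= s2 addrAC subrr add0r.
Qed.

(** The dimensions force postcomposition with [ext_out Z] to be onto End(V); a preimage of the
    identity is a section. *)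
Lemma dimHom_ext_cobound U V (Z : Z1 V U) :
    dimHom V (ext_rep Z) = (dimHom V U + dimHom V V)%N ->
  Z \in B1 V U.
Proof.
rewrite dimHom_ext => /addnI dimE.
have img : (postcomp V (ext_out Z) @: HomQ V (ext_rep Z))%VS = HomQ V V.
  by apply/eqP; rewrite eqEdim postcomp_img_sub ?ext_out_hom //= dimE.
pose idV : C0 V V := mkvfam (fun=> \1%VF).
have : idV \in HomQ V V.
  by apply/HomQP => a; rewrite !mkvfamE comp_lfun1l comp_lfun1r.
rewrite -img => /memv_imgP[s sP /vfamP sid].
apply: ext_section_cobound sP _ => x v.
have := congr1 (fun h : 'Hom(_, _) => h v) (sid x).
by rewrite postcompE comp_lfunE !mkvfamE !lfunE.
Qed.

End HomDimension.

(** * Matrix points: isomorphisms and orbits *)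

Section Orbits.
Variables (k : fieldType) (Q : quiver) (d : vertex Q -> nat).
Implicit Types L M : repd k d.

(** Has the shape of the body of [hat], so that [mul_mx_of] applies to the latter directly. *)
Definition mx_of m n (f : 'cV[k]_n -> 'cV[k]_m) : 'M[k]_(m, n) :=
  \matrix_(i, j) f (delta_mx j 0) i 0.

Lemma mul_mx_of m n (f : {linear 'cV[k]_n -> 'cV[k]_m}) v : mx_of f *m v = f v.
Proof.
have -> : v = \sum_j v j 0 *: delta_mx j 0.
  by rewrite [LHS]matrix_sum_delta; apply: eq_bigr => j _; rewrite big_ord1.
rewrite linear_sum linear_sum; apply: eq_bigr => j _; rewrite !linearZ /=.
by congr (_ *: _); rewrite -colE; apply/colP => i; rewrite !mxE.
Qed.

Lemma mulmx_cV_inj m n (A B : 'M[k]_(m, n)) :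
  (forall v : 'cV[k]_n, A *m v = B *m v) -> A = B.
Proof.
move=> AB; apply/matrixP => i j; move: (AB (delta_mx j 0)).
by rewrite -!colE => /colP/(_ i); rewrite !mxE.
Qed.

Lemma rep_iso_orbit L M :
  rep_iso (point_rep L) (point_rep M) -> rep_orbit L M.
Proof.
case=> f [g [/HomQP fP _ gf fg]].
pose A x := mx_of (f x : 'cV_(d x) -> 'cV_(d x)).
pose B x := mx_of (g x : 'cV_(d x) -> 'cV_(d x)).
have AB x : A x *m B x = 1%:M.
  apply: mulmx_cV_inj => v; rewrite -mulmxA !mul_mx_of mul1mx.
  by have := congr1 (fun h : 'Hom(_, _) => h v) (fg x); rewrite comp_lfunE id_lfunE.
exists A => [x|a]; first by case: (mulmx1_unit (AB x)).
have [As _] := mulmx1_unit (AB (src a)).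
(* Multiplying on the right by the invertible [A (src a)] turns conjugation into the intertwining
   relation of [f]. *)
apply: (can_inj (mulmxK As)); rewrite mulmxKV //; apply: mulmx_cV_inj => v.
rewrite -!mulmxA !mul_mx_of.
have := congr1 (fun h : 'Hom(_, _) => h v) (fP a).
by rewrite !comp_lfunE !lfunE.
Qed.

(** The inverse of a bijective morphism is again a morphism, so compatibility with the arrows is
    asked of [f] alone. *)
Lemma rep_isoE L M (f g : forall x, 'End('cV[k]_(d x))) :
    (forall a v, f (tgt a) (L a *m v) = M a *m f (src a) v) ->
    (forall x, cancel (f x) (g x)) -> (forall x, cancel (g x) (f x)) ->
  rep_iso (point_rep L) (point_rep M).
Proof.
move=> fP fK gK; exists (mkvfam f), (mkvfam g); split.
- apply/HomQP => a; apply/lfunP => v.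
  by rewrite !comp_lfunE !mkvfamE !lfunE /= fP.
- apply/HomQP => a; apply/lfunP => v; rewrite !comp_lfunE !mkvfamE !lfunE /=.
  by apply: (can_inj (fK _)); rewrite gK fP gK.
- by move=> x; apply/lfunP => v; rewrite comp_lfunE !mkvfamE fK id_lfunE.
- by move=> x; apply/lfunP => v; rewrite comp_lfunE !mkvfamE gK id_lfunE.
Qed.

(* Stated for variables M and M': on concrete points the conversion test between
   the two ambient spaces does not terminate in practice. *)
Lemma eq_dim_C0 (X : rep k Q) M M' (A : {vspace C0 X (point_rep M)})
    (A' : {vspace C0 X (point_rep M')}) :
    (forall h : vfam (fun x => 'Hom(rep_space X x, 'cV[k]_(d x))),
      ((h : C0 X (point_rep M)) \in A) = ((h : C0 X (point_rep M')) \in A')) ->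
  \dim A = \dim A'.
Proof. by move=> AA'; congr (\dim _); apply/vspaceP. Qed.

End Orbits.

(** * Components along a decomposition of [N] *)

Section Summands.
Variables (k : fieldType) (Q : quiver) (d : vertex Q -> nat).
Variables (N : repd k d) (S : finType) (D : decomposition N S).

Fact dec_proj_is_linear s x : linear (@dec_proj _ _ _ _ _ D s x).
Proof. by move=> c u v; rewrite /dec_proj !linearP. Qed.
HB.instance Definition _ s x := GRing.isLinear.Build k _ _ _ _
  (@dec_proj_is_linear s x).

Lemma sum_dec_proj x (v : 'cV[k]_(d x)) :
  v = \sum_s vsval (dec_proj D s v).
Proof.
have v_sum : v \in (\sum_t dec_space D t x)%VS by rewrite dec_full memvf.
rewrite -[LHS](sumv_pi_sum (erefl _) v_sum); apply: eq_bigr => s _.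
by rewrite vsprojK // memv_sum_pi.
Qed.

Lemma dec_proj_val s t x (u : subvs_of (dec_space D s x)) :
  vsval (dec_proj D t (vsval u)) = if t == s then vsval u else 0.
Proof.
(* The vector becomes the sum of a family supported at [s], the form expected by [dec_projE]. *)
have -> : vsval u = \sum_r (if r == s then vsval u else 0).
  by rewrite -big_mkcond big_pred1_eq.
rewrite dec_projE => [|r]; last by case: eqP => [->|_]; rewrite ?subvsP ?mem0v.
by case: eqP; rewrite // -big_mkcond big_pred1_eq.
Qed.

Lemma dec_proj_valK s x : cancel vsval (@dec_proj _ _ _ _ _ D s x).
Proof. by move=> u; apply: val_inj; rewrite /= dec_proj_val eqxx. Qed.

Lemma dec_proj_val_neq s t x (u : subvs_of (dec_space D s x)) :
  t != s -> dec_proj D t (vsval u) = 0.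
Proof. by move=> ts; apply: val_inj; rewrite /= dec_proj_val (negPf ts). Qed.

Lemma mulmx_summand s a (u : subvs_of (dec_space D s (src a))) :
  N a *m vsval u = vsval (summand D s a u).
Proof. by rewrite lfunE /= vsprojK // dec_stable // subvsP. Qed.

(** Every summand is stable under [N], so the components of [v] outside [s] contribute nothing. *)
Lemma dec_proj_mulmx s a v :
  dec_proj D s (N a *m v) = summand D s a (dec_proj D s v).
Proof.
rewrite [in LHS](sum_dec_proj v) mulmx_sumr linear_sum (bigD1 s) //=.
rewrite mulmx_summand dec_proj_valK big1 ?addr0 // => t ts.
by rewrite mulmx_summand dec_proj_val_neq // eq_sym.
Qed.

(** * The point [N + hat Z] and the middle term of sigma *)

Section Hat.
Variables (p q : S) (hpq : p != q).
Implicit Type Z : Z1 (summand D q) (summand D p).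

Lemma mulmx_hat Z a v : hat Z a *m v = vsval (Z a (dec_proj D q v)).
Proof.
rewrite /hat mkvfamE.
exact: (mul_mx_of (vsval \o (Z a \o @dec_proj _ _ _ _ _ D q (src a)))).
Qed.

Lemma hatZ c Z : hat (c *: Z) = c *: hat Z.
Proof.
apply/vfamP => a; apply: mulmx_cV_inj => v.
by rewrite vfamZE -scalemxAl !mulmx_hat vfamZE scale_lfunE linearZ.
Qed.

Lemma hat0 : hat (0 : Z1 (summand D q) (summand D p)) = 0.
Proof. by rewrite -[in LHS](scale0r 0) hatZ scale0r. Qed.

(** Inclusion and retraction are given by formulas free of [Z], which enters only through the arrow
    maps. *)
Definition ext_incl_fun x (w : ext_space (summand D p) (summand D q) x) :
  'cV[k]_(d x) := vsval w.1 + vsval w.2.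
Definition ext_retr_fun x (v : 'cV[k]_(d x)) :
  ext_space (summand D p) (summand D q) x := (dec_proj D p v, dec_proj D q v).

Fact ext_incl_fun_is_linear x : linear (@ext_incl_fun x).
Proof.
move=> c u v; rewrite /ext_incl_fun scalerDr addrACA.
by congr (_ + _); apply: linearP.
Qed.
HB.instance Definition _ x := GRing.isLinear.Build k _ _ _ _
  (@ext_incl_fun_is_linear x).
Fact ext_retr_fun_is_linear x : linear (@ext_retr_fun x).
Proof. by move=> c u v; rewrite /ext_retr_fun; congr (_, _); apply: linearP. Qed.
HB.instance Definition _ x := GRing.isLinear.Build k _ _ _ _
  (@ext_retr_fun_is_linear x).

Definition ext_incl Z : C0 (ext_rep Z) (point_rep (N + hat Z)) :=
  mkvfam (fun x => linfun (@ext_incl_fun x)).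
Definition ext_retr Z : C0 (point_rep (N + hat Z)) (ext_rep Z) :=
  mkvfam (fun x => linfun (@ext_retr_fun x)).

Lemma ext_inclE Z x w : ext_incl Z x w = vsval w.1 + vsval w.2.
Proof. by rewrite mkvfamE (lfunE (@ext_incl_fun x)). Qed.

Lemma ext_retrE Z x v : ext_retr Z x v = (dec_proj D p v, dec_proj D q v).
Proof. by rewrite mkvfamE (lfunE (@ext_retr_fun x)). Qed.

Lemma ext_repE Z a w : ext_rep Z a w =
  (summand D p a w.1 + Z a w.2, summand D q a w.2).
Proof. exact: lfunE. Qed.

Lemma point_hatE Z a v : point_rep (N + hat Z) a v =
  N a *m v + vsval (Z a (dec_proj D q v)).
Proof. by rewrite lfunE /= vfamDE mulmxDl mulmx_hat. Qed.

(** [hat Z] reads only the N^q component, and vectors of N^p have none because [p != q]. *)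
Lemma ext_incl_hom Z : ext_incl Z \in HomQ (ext_rep Z) (point_rep (N + hat Z)).
Proof.
apply/HomQP => a; apply/lfunP => -[u v]; rewrite !comp_lfunE ext_repE !ext_inclE /=.
rewrite point_hatE mulmxDr !mulmx_summand !linearD /= dec_proj_valK.
by rewrite dec_proj_val_neq 1?eq_sym // !linear0 add0r addrAC.
Qed.

(** The values of [hat Z] lie in N^p, so the projection to N^q does not see them. *)
Lemma ext_retr_hom Z : ext_retr Z \in HomQ (point_rep (N + hat Z)) (ext_rep Z).
Proof.
apply/HomQP => a; apply/lfunP => v; rewrite !comp_lfunE !ext_retrE ext_repE /=.
rewrite point_hatE !linearD /= !dec_proj_mulmx dec_proj_valK.
by rewrite dec_proj_val_neq 1?eq_sym // addr0.
Qed.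

Lemma ext_retr_incl Z x : (ext_retr Z x \o ext_incl Z x)%VF = \1%VF.
Proof.
apply/lfunP => -[u v]; rewrite comp_lfunE ext_retrE ext_inclE id_lfunE /=.
rewrite !linearD /= !dec_proj_valK !dec_proj_val_neq ?addr0 ?add0r //.
by rewrite eq_sym.
Qed.

(* A morphism X -> N + hat Z killed by the retraction has no component in N^q,
   so it does not see hat Z. *)
Lemma ker_ext_retrP X Z (h : vfam (fun x => 'Hom(rep_space X x, 'cV[k]_(d x)))) :
  reflect ((forall a v, h (tgt a) (X a v) = N a *m h (src a) v) /\
           (forall x v, dec_proj D p (h x v) = 0 /\ dec_proj D q (h x v) = 0))
    ((h : C0 X (point_rep (N + hat Z))) \in
       (HomQ X (point_rep (N + hat Z)) :&: lker (postcomp X (ext_retr Z)))%VS).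
Proof.
have mapE a v : dec_proj D q (h (src a) v) = 0 ->
    point_rep (N + hat Z) a (h (src a) v) = N a *m h (src a) v.
  by move=> hq; rewrite point_hatE hq !linear0 addr0.
rewrite memv_cap; apply: (iffP andP) => [[/HomQP hP hker]|[hP h0]].
  have h0 x v : dec_proj D p (h x v) = 0 /\ dec_proj D q (h x v) = 0.
    move: hker; rewrite memv_ker => /eqP/vfamP/(_ x); rewrite postcompE vfam0E.
    move/(congr1 (fun f : 'Hom(_, _) => f v)).
    by rewrite comp_lfunE ext_retrE zero_lfunE => -[].
  split=> // a v; rewrite -mapE; last by case: (h0 (src a) v).
  have := congr1 (fun f : 'Hom(_, _) => f v) (hP a).
  by rewrite !comp_lfunE.
split.
  apply/HomQP => a; apply/lfunP => v; rewrite !comp_lfunE hP mapE //.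
  by case: (h0 (src a) v).
rewrite memv_ker; apply/eqP/vfamP => x; rewrite postcompE vfam0E; apply/lfunP => v.
by rewrite comp_lfunE ext_retrE zero_lfunE; case: (h0 x v) => -> ->.
Qed.

(** The characterization in [ker_ext_retrP] does not mention [Z]. *)
Lemma dim_ker_ext_retr X Z Z' :
  \dim (HomQ X (point_rep (N + hat Z)) :&: lker (postcomp X (ext_retr Z))) =
  \dim (HomQ X (point_rep (N + hat Z')) :&: lker (postcomp X (ext_retr Z'))).
Proof.
apply: eq_dim_C0 => h.
by apply/ker_ext_retrP/ker_ext_retrP.
Qed.

(** The equations of [dimHom_retract] for [Z] and for 0 share their kernel term; eliminating it
    gives this relation, written additively to avoid truncated subtraction. *)
Lemma dimHom_hat X Z :
  (dimHom X (point_rep (N + hat Z))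
     + dimHom X (ext_rep (0 : Z1 (summand D q) (summand D p)))
   = dimHom X (point_rep N) + dimHom X (ext_rep Z))%N.
Proof.
have retr Y := dimHom_retract X (ext_incl_hom Y) (ext_retr_hom Y) (ext_retr_incl Y).
have dimN : dimHom X (point_rep N) =
    dimHom X (point_rep (N + hat (0 : Z1 (summand D q) (summand D p)))).
  by rewrite hat0 addr0.
have add_ker (m n e e0 c c0 : nat) : (m = c + e -> n = c0 + e0 -> c = c0 ->
    m + e0 = n + e)%N by move=> -> -> ->; rewrite addnAC.
exact: add_ker (retr Z) (etrans dimN (retr 0)) (dim_ker_ext_retr X Z 0).
Qed.

(** The isomorphism [f t] is [t] on N^p and the identity on the other summands: it commutes with [N]
    and multiplies [hat Z], which goes from N^q to N^p, by [t]. *)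
Lemma iso_hatZ Z (t : k) :
  t != 0 -> rep_iso (point_rep (N + hat Z)) (point_rep (N + t *: hat Z)).
Proof.
move=> t0.
pose P x : 'End('cV[k]_(d x)) := linfun (vsval \o @dec_proj _ _ _ _ _ D p x).
have PE x v : P x v = vsval (dec_proj D p v) by rewrite lfunE.
have PP x v : P x (P x v) = P x v by rewrite !PE dec_proj_valK.
pose f (c : k) x : 'End('cV[k]_(d x)) := \1%VF + (c - 1) *: P x.
have fE c x v : f c x v = v + (c - 1) *: P x v.
  by rewrite add_lfunE scale_lfunE id_lfunE.
have fM b c x : b * c = 1 -> cancel (f c x) (f b x).
  move=> bc v; rewrite !fE linearD linearZ /= PP -addrA.
  rewrite scalerDr scalerA -!scalerDl.
  (* The coefficient of [P] in [f b] after [f c] is [b * c - 1] in expanded form. *)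
  have -> : c - 1 + (b - 1 + (b - 1) * (c - 1)) = 0.
    rewrite mulrBr mulr1 mulrBl bc mul1r [b - 1 + _]addrC subrK.
    by rewrite addrA subrK subrr.
  by rewrite scale0r addr0.
apply: (rep_isoE (f := f t) (g := f t^-1)) => [a v|x|x]; last 2 first.
- by apply: fM; rewrite mulVf.
- by apply: fM; rewrite mulfV.
have HP : hat Z a *m P (src a) v = 0.
  by rewrite mulmx_hat PE dec_proj_val_neq 1?eq_sym // !linear0.
have PH : P (tgt a) (hat Z a *m v) = hat Z a *m v.
  by rewrite PE mulmx_hat dec_proj_valK.
have PN : P (tgt a) (N a *m v) = N a *m P (src a) v.
  by rewrite !PE dec_proj_mulmx mulmx_summand.
rewrite !fE !vfamDE !vfamZE !mulmxDl !mulmxDr -!scalemxAl -!scalemxAr HP.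
rewrite linearD /= PH PN !scaler0 addr0 scalerDr.
rewrite [(t - 1) *: (hat Z a *m v)]scalerBl scale1r.
by rewrite [in LHS]addrACA [_ + (t *: _ - _)]addrC subrK.
Qed.

(** Here [hat Z = H N - N H], where [H] maps N^q into N^p and kills the other summands. Hence
    [H H = 0], and [1 - H] has inverse [1 + H]. *)
Lemma iso_hat_cobound Z : Z \in B1 (summand D q) (summand D p) ->
  rep_iso (point_rep (N + hat Z)) (point_rep N).
Proof.
case/memv_imgP => h _ ZE.
pose H x : 'End('cV[k]_(d x)) :=
  linfun (vsval \o (h x \o @dec_proj _ _ _ _ _ D q x)).
have HE x v : H x v = vsval (h x (dec_proj D q v)) by rewrite lfunE.
have HH x v : H x (H x v) = 0.
  by rewrite !HE dec_proj_val_neq 1?eq_sym // !linear0.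
have hatE a v : hat Z a *m v = H (tgt a) (N a *m v) - N a *m H (src a) v.
  rewrite mulmx_hat ZE lfunE /= mkvfamE add_lfunE opp_lfunE !comp_lfunE.
  by rewrite linearB !HE dec_proj_mulmx mulmx_summand.
(* [N] preserves N^p, on which [H] vanishes; this removes the last quadratic term from the
   intertwining relation. *)
have HNH a v : H (tgt a) (N a *m H (src a) v) = 0.
  by rewrite !HE mulmx_summand dec_proj_val_neq 1?eq_sym // !linear0.
apply: (rep_isoE (f := fun x => \1%VF - H x) (g := fun x => \1%VF + H x))
  => [a v|x v|x v];
  rewrite ?(add_lfunE, opp_lfunE, id_lfunE).
- rewrite vfamDE mulmxDl hatE mulmxBr.
  rewrite [H _ (_ + _)]linearD /= [H _ (_ - _)]linearB /= HH HNH subrr addr0.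
  by rewrite [H _ _ - _]addrC addrA addrK.
- by rewrite linearB /= HH subr0 subrK.
- by rewrite linearD /= HH addr0 addrK.
Qed.

End Hat.
End Summands.

(** * Limits along a punctured line, and the theorem *)

(* If F vanishes off 0 then F * X + 1 has no root. *)
Lemma closed_field_poly_eq0 (k : closedFieldType) (F : {poly k}) :
  (forall t, t != 0 -> F.[t] = 0) -> F = 0.
Proof.
move=> F0; apply/eqP/negPn/negP => Fn0.
have /closed_rootP[t] : size (F * 'X + 1) != 1%N.
  by rewrite size_polyDl size_mulX ?size_poly1 // ?eqSS ?ltnS ?lt0n size_poly_eq0.
rewrite /root !hornerE; have [->|/F0->] := eqVneq t 0.
  by rewrite mulr0 add0r oner_eq0.
by rewrite mul0r add0r oner_eq0.
Qed.

(** Restricted to the line, [f] is a polynomial in [t] that vanishes for [t != 0], hence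
    identically, in particular at [t = 0]. *)
Lemma zariski_closure_line (k : closedFieldType) (Q : quiver)
    (d : vertex Q -> nat) (P : repd k d -> Prop) (N H : repd k d) :
  (forall t, t != 0 -> P (N + t *: H)) -> zariski_closure P N.
Proof.
move=> PH f f0.
(* [f] with each coordinate replaced by its affine expression in ['X], expanded over monomials to
   match [mevalE]. *)
pose F : {poly k} := \sum_(m <- msupp f) f@_m *:
  \prod_i ((coordinates N i)%:P + coordinates H i *: 'X) ^+ m i.
have FE t : F.[t] = f.@[coordinates (N + t *: H)].
  rewrite mevalE horner_sum; apply: eq_bigr => m _.
  rewrite hornerZ horner_prod; congr (_ * _); apply: eq_bigr => i _.
  by rewrite horner_exp !hornerE /coordinates vfamDE vfamZE !mxE mulrC.
have F0 : F = 0.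
  by apply: closed_field_poly_eq0 => t t0; rewrite FE f0 //; apply: PH.
by have := FE 0; rewrite F0 horner0 scale0r addr0.
Qed.

Theorem lemma3p2 (k : closedFieldType) (Q : quiver) (hQ : dynkin_quiver Q)
    (d : vertex Q -> nat) (N : repd k d) (S : finType)
    (D : decomposition N S) (p q : S) (hpq : p <> q)
    (Z : Z1 (summand D q) (summand D p)) :
  let L : repd k d := N + hat Z in
  [/\ delta (point_rep L) (point_rep N)
        =1 delta_ses (sigma (summand D p) Z),
      degenerates_to L N
    & rep_iso (point_rep L) (point_rep N)
        <-> Z \in B1 (summand D q) (summand D p)].
Proof.
have npq : p != q by apply/eqP.
move=> L; split=> [X||].
- rewrite /delta_ses /delta /= dimHom_dsum -dimHom_ext0.
  (* Moving the negative terms across leaves an identity of natural numbers, namely [dimHom_hat]. *)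
  apply/eqP; rewrite subr_eq addrAC eq_sym subr_eq -!PoszD addnC.
  by rewrite (dimHom_hat npq).
- apply: (zariski_closure_line (H := hat Z)) => t t0.
  by apply: rep_iso_orbit; apply: iso_hatZ.
split=> [isoLN|]; last exact: iso_hat_cobound.
(* In [dimHom_hat] at X = N^q the terms of [L] and [N] are equal and cancel, which leaves the
   required dimension of Hom(N^q, E). *)
apply: dimHom_ext_cobound; rewrite -dimHom_ext0.
have cancel_iso (m n e e0 : nat) : (m + e0 = n + e -> m = n -> e = e0)%N.
  by move=> eq_add eq_mn; move: eq_add; rewrite eq_mn => /addnI.
exact: cancel_iso (dimHom_hat npq (summand D q) Z) (dimHom_iso _ isoLN).
Qed.
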